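(* Let $\mathcal{H}$ be a complex Hilbert space and let $A,B\in\mathcal{B}(\mathcal{H})$ and $\lambda\in\mathbb{C}$ satisfy $AB=\lambda BA\neq 0$. Let $A$ be hyponormal and $B$ be quasi $*$-paranormal. If $A$ is invertible or $0$ is an isolated point of the spectrum $\sigma(A)$, then $|\lambda|=1$.
   Context: $\mathcal{B}(\mathcal{H})$ denotes the algebra of all bounded linear operators on the complex Hilbert space $\mathcal{H}$. An operator $T\in\mathcal{B}(\mathcal{H})$ is hyponormal if $T^*T\geq TT^*$, equivalently $\|T^*x\|\leq\|Tx\|$ for all $x\in\mathcal{H}$. It is quasi $*$-paranormal if $\|T^*Tx\|^2\leq\|T^3x\|\,\|Tx\|$ for all $x\in\mathcal{H}$. *)

(* Defs.v *)
From HB Require Import structures.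
From mathcomp Require Import all_boot all_order all_algebra.
From mathcomp Require Import all_classical all_reals all_analysis.
From mathcomp Require Import complex.

Set Implicit Arguments.
Unset Strict Implicit.
Unset Printing Implicit Defensive.

Import Order.TTheory GRing.Theory Num.Theory.
Import numFieldNormedType.Exports.

Local Open Scope classical_set_scope.
Local Open Scope ring_scope.

(* The inner product is linear in its first argument and conjugate-linear in
   the second. The norm takes values in R[i], where x <= y means that y - x is
   real and nonnegative. *)
HB.mixin Record CompleteNormedModule_isHilbert (R : realType) H
    & CompleteNormedModule R[i] H := {
  inner : {dot H for (@Num.conj R[i])} ;
  innerxx : forall x : H, inner x x = `|x| ^+ 2
}.

#[short(type="hilbertType")]
HB.structure Definition Hilbert (R : realType) :=
  {H of CompleteNormedModule R[i] H & CompleteNormedModule_isHilbert R H}.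

Notation "'[ x , y ]" := (inner x y) : ring_scope.

HB.mixin Record isBounded (R : realType) (H : hilbertType R) (T : H -> H) := {
  bounded_subproof : exists M : R[i], forall x : H, `|T x| <= M * `|x|
}.

#[short(type="boundedOperator")]
HB.structure Definition BoundedOperator (R : realType) (H : hilbertType R) :=
  {T of @GRing.Linear R[i] H H *:%R T & isBounded R H T}.

Section Operators.
Context {R : realType} {H : hilbertType R}.
Implicit Types T S : boundedOperator H.

(* Existence of the adjoint is the Riesz representation theorem and its
   uniqueness is definiteness of the inner product; the default value 0 of
   [xget] is never used on a bounded operator. *)
Definition adjoint T (y : H) : H := xget 0 [set z | forall x, '[T x, y] = '[x, z]].

(* The order of self-adjoint operators, here on plain functions. *)
Definition operator_ge (P Q : H -> H) := forall x, 0 <= '[P x - Q x, x].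

Definition hyponormal T := operator_ge (adjoint T \o T) (T \o adjoint T).

Definition quasi_star_paranormal T := forall x,
  `|adjoint T (T x)| ^+ 2 <= `|T (T (T x))| * `|T x|.

(* Invertibility in B(H): the inverse is itself bounded. *)
Definition invertible (P : H -> H) :=
  exists S : boundedOperator H, cancel P S /\ cancel S P.

Definition spectrum T : set R[i] :=
  [set z | ~ invertible (fun x => T x - z *: x)].

End Operators.

(* Main.v *)
(* Put w = 1/z and let q_N(w) = 1 - (w A)^N. If the circle |z| = r avoids the
   spectrum of A, then averaging (1 - A/z)^-1 over the N-th roots of r^N gives
   q_N(1/r)^-1, so these inverses are bounded uniformly in N; they approximate
   the Riesz projection of an isolated spectral point 0. Following Rickart's
   elementary proof of the spectral radius formula, the difference of these
   operators for two circles around 0 tends to 0 as N grows. On a small circle,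
   paranormality (a consequence of hyponormality) makes A small on their range;
   hence A q_N(1/r)^-1 -> 0, while A^(N-1) q_N(1/r)^-1 / r^(N-1) stays bounded.
   This yields a constant K such that |A y| <= K |A A y|, and such that every
   u in the range of A is a limit of vectors A w with w in the range of A and
   |w| <= K |u|. Both are clear if A is invertible.
   Since A B^n = lambda^n B^n A, these two properties show that a bound c for
   B^n on the range of A can be improved to K |A| |lambda|^n c and to
   K |A| |lambda|^-n c. If |lambda| <> 1 then B^n A = 0 for some n, and quasi
   *-paranormality of B brings this down to B A = 0. *)
Require Import Defs.
From mathcomp Require Import all_boot all_order all_algebra.
From mathcomp Require Import all_classical all_reals all_analysis.
From mathcomp Require Import complex.
From mathcomp Require Import cyclic separable cyclotomic zify ring lra.

Import Order.TTheory GRing.Theory Num.Theory.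
Import numFieldNormedType.Exports.

Local Open Scope classical_set_scope.
Local Open Scope ring_scope.
Local Open Scope complex_scope.

Set Implicit Arguments.
Unset Strict Implicit.

(** * Real-valued norm and inner product *)

Section RealNorm.
Context {R : realType} {V : normedZmodType R[i]}.
Implicit Types x y : V.

(* The norm of the library takes its values in [R[i]], which is not totally
   ordered; all the estimates are carried out with its real part. *)
Definition rnorm x : R := complex.Re `|x|.

Lemma normE x : `|x| = (rnorm x)%:C.
Proof. by rewrite /rnorm RRe_real// normr_real. Qed.

Lemma rnorm_ge0 x : 0 <= rnorm x.
Proof. by rewrite -ler0c -normE. Qed.

Lemma rnorm0 : rnorm 0 = 0.
Proof. by rewrite /rnorm normr0. Qed.

Lemma rnorm_eq0 x : (rnorm x == 0) = (x == 0).
Proof. by rewrite -[RHS]normr_eq0 normE eq_complex /= eqxx andbT. Qed.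

Lemma rnorm_gt0 x : (0 < rnorm x) = (x != 0).
Proof. by rewrite lt_def rnorm_ge0 andbT rnorm_eq0. Qed.

Lemma rnormN x : rnorm (- x) = rnorm x.
Proof. by rewrite /rnorm normrN. Qed.

Lemma rnormB x y : rnorm (x - y) = rnorm (y - x).
Proof. by rewrite -rnormN opprB. Qed.

Lemma ler_rnormD x y : rnorm (x + y) <= rnorm x + rnorm y.
Proof. by rewrite -lecR rmorphD /= -!normE ler_normD. Qed.

Lemma ler_rnorm_sum (I : Type) (s : seq I) (F : I -> V) :
  rnorm (\sum_(i <- s) F i) <= \sum_(i <- s) rnorm (F i).
Proof.
elim/big_rec2: _ => [|i u v _ h]; first by rewrite rnorm0.
by rewrite (le_trans (ler_rnormD _ _))// lerD2l.
Qed.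

End RealNorm.

Section RealNormScalar.
Context {R : realType}.
Implicit Types z w : R[i].

Lemma rnormM z w : rnorm (z * w) = rnorm z * rnorm w.
Proof. by apply: complexI; rewrite rmorphM /= -!normE normrM. Qed.

Lemma rnorm1 : rnorm (1 : R[i]) = 1.
Proof. by rewrite /rnorm normr1. Qed.

Lemma rnormX z n : rnorm (z ^+ n) = rnorm z ^+ n.
Proof. by elim: n => [|n IH]; rewrite ?rnorm1// !exprS rnormM IH. Qed.

Lemma rnormV z : rnorm z^-1 = (rnorm z)^-1.
Proof.
have [->|z0] := eqVneq z 0; first by rewrite !(invr0, rnorm0).
have r0 : rnorm z != 0 by rewrite rnorm_eq0.
by apply: (mulfI r0); rewrite -rnormM !divff// rnorm1.
Qed.

Lemma rnormC (a : R) : rnorm a%:C = `|a|.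
Proof. by rewrite /rnorm normc_def /= expr0n/= addr0 sqrtr_sqr. Qed.

Lemma rnormZ (V : normedModType R[i]) z (x : V) :
  rnorm (z *: x) = rnorm z * rnorm x.
Proof. by apply: complexI; rewrite rmorphM /= -!normE normrZ. Qed.

End RealNormScalar.

Section RealInner.
Context {R : realType} {H : hilbertType R}.
Implicit Types x y z : H.

(** Passing to the real part loses nothing: the imaginary part of ['[x, y]] is read off after
    replacing x by ['i *: x]. *)
Definition rinner x y : R := complex.Re '[x, y].

Lemma rinnerC x y : rinner x y = rinner y x.
Proof.
apply: complexI; rewrite /rinner [in LHS](hermC inner) expr0 mul1r.
by rewrite !complexRe Re_conj.
Qed.

Lemma rinnerDl x y z : rinner (x + y) z = rinner x z + rinner y z.
Proof. by rewrite /rinner linearDl raddfD. Qed.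

Lemma rinnerDr x y z : rinner x (y + z) = rinner x y + rinner x z.
Proof. by rewrite rinnerC rinnerDl !(rinnerC x). Qed.

Lemma rinnerNl x y : rinner (- x) y = - rinner x y.
Proof. by rewrite /rinner linearNl raddfN. Qed.

Lemma rinnerNr x y : rinner x (- y) = - rinner x y.
Proof. by rewrite rinnerC rinnerNl rinnerC. Qed.

Lemma rinnerZl (a : R) x y : rinner (a%:C *: x) y = a * rinner x y.
Proof. by rewrite /rinner linearZl_LR /=; case: '[x, y] => u v /=; ring. Qed.

Lemma rinnerZr (a : R) x y : rinner x (a%:C *: y) = a * rinner x y.
Proof. by rewrite rinnerC rinnerZl rinnerC. Qed.

Lemma rinnerxx x : rinner x x = rnorm x ^+ 2.
Proof. by apply: complexI; rewrite /rinner innerxx normE -rmorphXn. Qed.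

Lemma rnormD_sqr x y :
  rnorm (x + y) ^+ 2 = rnorm x ^+ 2 + 2 * rinner x y + rnorm y ^+ 2.
Proof.
rewrite -!rinnerxx !(rinnerDl, rinnerDr) (rinnerC y x); ring.
Qed.

(** Cauchy-Schwarz, by expanding the squared norm of |y| x - |x| y. *)
Lemma rinner_le x y : rinner x y <= rnorm x * rnorm y.
Proof.
have [->|y0] := eqVneq y 0.
  by rewrite rnorm0 mulr0 /rinner linear0r.
have [->|x0] := eqVneq x 0.
  by rewrite rnorm0 mul0r /rinner linear0l.
have px : 0 < rnorm x by rewrite rnorm_gt0.
have py : 0 < rnorm y by rewrite rnorm_gt0.
have := sqr_ge0 (rnorm ((rnorm y)%:C *: x + (- rnorm x)%:C *: y)).
rewrite rnormD_sqr rinnerZl rinnerZr !rnormZ !rnormC normrN !(ger0_norm (rnorm_ge0 _)).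
move=> h; rewrite -(ler_pM2l (mulr_gt0 px py)); lra.
Qed.

End RealInner.

(** * Riesz representation, adjoints and operator inequalities *)

Section Riesz.
Context {R : realType} {H : hilbertType R}.

(* The representing vector minimizes [|x|^2 - 2 f x]; by the parallelogram law
   a minimizing sequence is Cauchy. *)
Lemma riesz_real (f : H -> R) (M : R) :
  {morph f : x y / x + y} -> (forall (a : R) x, f (a%:C *: x) = a * f x) ->
  (forall x, f x <= M * rnorm x) ->
  exists z, forall x, f x = rinner x z.
Proof.
move=> fD fZ fM.
pose J x := rnorm x ^+ 2 - 2 * f x.
(* Completing the square: |x|^2 - 2 M |x| >= - M^2. *)
have J_ge x : - M ^+ 2 <= J x.
  by rewrite /J; have := fM x; have := sqr_ge0 (rnorm x - M); nra.
have Jinf : has_inf (range J).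
  by split; [exists (J 0), 0 | exists (- M ^+ 2) => _ [x _ <-]].
pose m := inf (range J).
have m_le x : m <= J x by apply: ge_inf; [case: Jinf | exists x].
have /choice[u uP] : forall n : nat, exists x, J x < m + n.+1%:R^-1.
  move=> n; have [|_ [x _ <-] Jx] := @inf_adherent R (range J) n.+1%:R^-1 _ Jinf.
    by rewrite invr_gt0 ltr0n.
  by exists x.
(* For the midpoint p the parallelogram law reads |u n - u k|^2 = 2 J (u n) + 2 J (u k) - 4 J p, and
   m <= J p. *)
have uB n k : rnorm (u n - u k) ^+ 2 <= 2 * (n.+1%:R^-1 + k.+1%:R^-1).
  have := uP n; have := uP k; have := m_le ((2^-1)%:C *: (u n + u k)).
  rewrite /J fZ fD rnormZ rnormC ger0_norm ?invr_ge0// exprMn.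
  have := rnormD_sqr (u n) (u k); have := rnormD_sqr (u n) (- u k).
  rewrite rnormN rinnerNr; move: (n.+1%:R^-1) (k.+1%:R^-1) => a b; clear; nra.
have invn_near e : 0 < e -> \forall n \near \oo, n.+1%:R^-1 < e :> R.
  by move=> e0; exact: (near_infty_natSinv_lt (PosNum e0)).
have : exists z : H, u n @[n --> \oo] --> z.
  suff uc : cauchy (u @ \oo) by exists (lim (u @ \oo)); exact: cauchy_cvg.
  apply: (@cauchy_exP R[i] H) => e e0.
  have [e' e'E] : exists e', e = e'%:C.
    by apply/complex_realP/gtr0_real.
  move: e0; rewrite e'E ltcR => e'0.
  have : \forall n \near \oo, n.+1%:R^-1 < e' ^+ 2 / 4 :> R.
    by apply: invn_near; rewrite divr_gt0 ?exprn_gt0.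
  move=> [N _ NP]; exists (u N); exists N => // n /= Nn.
  rewrite -ball_normE /= normE ltcR -(ltr_pXn2r (n:=2)) ?nnegrE ?rnorm_ge0 ?(ltW e'0)//.
  apply: le_lt_trans (uB _ _) _.
  have := NP N (leqnn N); have := NP n Nn; rewrite /=;
    move: (n.+1%:R^-1) (N.+1%:R^-1) => a b; clear; lra.
move=> [z uz]; exists z => w.
(* The expression is J (z + t w) - J z; its sign is obtained up to e from the near-minimality of
   [u n] for [u n] close to z. *)
have key t : 0 <= t ^+ 2 * rnorm w ^+ 2 - 2 * t * (f w - rinner w z).
  apply/ler_addgt0Pr => e e0.
  pose c := 2 * `|t| * rnorm w + 1.
  have c0 : 0 < c by rewrite /c ltr_pwDr ?mulr_ge0// rnorm_ge0.
  have e2c : 0 < e / 2 / c by rewrite !divr_gt0.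
  have [n [n1 n2]] : exists n, n.+1%:R^-1 < e / 2 /\ rnorm (z - u n) < e / 2 / c.
    have near1 := invn_near _ (divr_gt0 e0 (ltr0Sn _ 1)).
    have near2 : \forall n \near \oo, rnorm (z - u n) < e / 2 / c.
      have /cvgrPdist_lt/(_ (e / 2 / c)%:C) := uz.
      rewrite ltcR => /(_ e2c); apply: filterS => n.
      by rewrite normE ltcR.
    by have [n nP] := filter_ex (filterI near1 near2); exists n.
  have := m_le (u n + t%:C *: w); have := uP n.
  rewrite /J rnormD_sqr rnormZ rnormC exprMn real_normK ?num_real// fD fZ rinnerZr => h1 h2.
  have h3 : t * (rinner w (u n) - rinner w z) <= e / 4.
    have -> : t * (rinner w (u n) - rinner w z) = rinner (t%:C *: w) (u n - z).
      by rewrite rinnerZl rinnerDr rinnerNr.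
    apply: le_trans (rinner_le _ _) _; rewrite rnormZ rnormC rnormB.
    rewrite ltr_pdivlMr// in n2.
    have := rnorm_ge0 (z - u n); rewrite /c in n2; nra.
  move: n1 h1 h2 h3; rewrite (rinnerC (u n)); move: (n.+1%:R^-1) => a; clear; nra.
have W : 0 < rnorm w ^+ 2 + 1 by rewrite ltr_wpDl ?sqr_ge0.
(* With d = f w - <w, z>, the best t would be d / |w|^2. The summand 1 avoids division by 0 and
   still leaves - t^2 (|w|^2 + 2) >= 0, so d = 0. *)
have := key ((f w - rinner w z) / (rnorm w ^+ 2 + 1)).
set d := f w - rinner w z; rewrite /=.
have -> : (d / (rnorm w ^+ 2 + 1)) ^+ 2 * rnorm w ^+ 2 -
  2 * (d / (rnorm w ^+ 2 + 1)) * d =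
  - (d / (rnorm w ^+ 2 + 1)) ^+ 2 * (rnorm w ^+ 2 + 2).
  by field; rewrite gt_eqF.
rewrite mulNr oppr_ge0 => h.
have : d / (rnorm w ^+ 2 + 1) == 0.
  rewrite -sqrf_eq0 eq_le sqr_ge0 andbT -(pmulr_lle0 _ (_ : 0 < rnorm w ^+ 2 + 2))//.
  by rewrite ltr_wpDl ?sqr_ge0.
by rewrite mulf_eq0 invr_eq0 (gt_eqF W) orbF subr_eq0 => /eqP.
Qed.
End Riesz.

Section Adjoint.
Context {R : realType} {H : hilbertType R}.
Implicit Types (T : boundedOperator H) (x y : H).

(** The given constant is complex; one more than its norm is a positive real bound. *)
Lemma bounded_rnorm T : exists2 M : R, 0 < M & forall x, rnorm (T x) <= M * rnorm x.
Proof.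
have [M MP] := @bounded_subproof R H T.
exists (rnorm M + 1) => [|x]; first by rewrite ltr_wpDl ?rnorm_ge0.
apply: (@le_trans _ _ (rnorm M * rnorm x)); last first.
  by rewrite mulrDl mul1r lerDl rnorm_ge0.
have := MP x; have /ger0_norm := le_trans (normr_ge0 _) (MP x).
by rewrite normrM normr_id => <-; rewrite !normE -rmorphM lecR.
Qed.

(** [riesz_real] represents the real part of the functional; evaluating at ['i *: u] then gives the
    imaginary part. *)
Lemma adjointP T x y : '[T x, y] = '[x, adjoint T y].
Proof.
suff [z zP] : exists z, forall x, '[T x, y] = '[x, z].
  by rewrite /adjoint; case: xgetP => [w _ /(_ x)//|/(_ z)].
have [M M0 TM] := bounded_rnorm T.
have [|a u||z zP] := @riesz_real R H (fun x => rinner (T x) y) (M * rnorm y).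
- by move=> u v; rewrite linearD rinnerDl.
- by rewrite linearZ /= rinnerZl.
- by move=> u; apply: le_trans (rinner_le _ _) _; have := TM u; have := rnorm_ge0 y; nra.
exists z => u; have := zP u; have := zP ('i *: u).
rewrite /rinner linearZ /= !linearZl_LR /= -complexiE.
by case: '[T u, y] => a b; case: '[u, z] => c d /=; rewrite !(mul0r, mul1r, sub0r)
  => /oppr_inj -> ->.
Qed.

Lemma rinner_adjoint T x y : rinner (T x) y = rinner x (adjoint T y).
Proof. by rewrite /rinner adjointP. Qed.

Lemma hyponormal_adjoint_le T x :
  hyponormal T -> rnorm (adjoint T x) <= rnorm (T x).
Proof.
move=> /(_ x); rewrite lecE => /andP[_]; rewrite -/(rinner _ _) /=.
rewrite rinnerDl rinnerNl rinner_adjoint (rinnerC _ x) -rinner_adjoint !rinnerxx.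
by rewrite subr_ge0 ler_pXn2r ?nnegrE ?rnorm_ge0.
Qed.

(** By Cauchy-Schwarz |T x|^2 = <adjoint T (T x), x> <= |adjoint T (T x)| |x|, and hyponormality at
    T x replaces the adjoint by T. *)
Lemma hyponormal_paranormal T x :
  hyponormal T -> rnorm (T x) ^+ 2 <= rnorm (T (T x)) * rnorm x.
Proof.
move=> hT; rewrite -rinnerxx rinner_adjoint rinnerC.
apply: le_trans (rinner_le _ _) _.
by rewrite ler_wpM2r ?rnorm_ge0// hyponormal_adjoint_le.
Qed.

(** The defining inequality forces adjoint T (T x) = 0, and |T x|^2 = <x, adjoint T (T x)>. *)
Lemma quasi_star_paranormal_kernel T x :
  quasi_star_paranormal T -> T (T (T x)) = 0 -> T x = 0.
Proof.
move=> /(_ x) h e; apply/eqP; rewrite -rnorm_eq0 -sqrf_eq0 -rinnerxx.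
have -> : rinner (T x) (T x) = rinner x (adjoint T (T x)) by rewrite rinner_adjoint.
suff -> : adjoint T (T x) = 0 by rewrite /rinner linear0r.
apply/eqP; rewrite -normr_eq0 -sqrf_eq0 eq_le exprn_ge0 ?normr_ge0// andbT.
by move: h; rewrite e normr0 mul0r.
Qed.

End Adjoint.

(** * Polynomials in a linear operator *)

Section PolynomialCalculus.
Context {R : realType} {V : normedModType R[i]} (A : {linear V -> V}).
Implicit Types (p q u : {poly R[i]}) (x y : V) (a b : R).

Definition polyop p x : V := \sum_(i < size p) p`_i *: iter i A x.

Lemma polyop_wide n p x :
  (size p <= n)%N -> polyop p x = \sum_(i < n) p`_i *: iter i A x.
Proof.
move=> pn; rewrite /polyop (big_ord_widen n (fun i => p`_i *: iter i A x))//.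
rewrite big_mkcond/=; apply: eq_bigr => i _.
by case: ltnP => // /(nth_default 0) ->; rewrite scale0r.
Qed.

Lemma polyopD p q x : polyop (p + q) x = polyop p x + polyop q x.
Proof.
rewrite !(@polyop_wide (maxn (size p) (size q))) ?leq_maxl ?leq_maxr ?size_polyD//.
by rewrite -big_split/=; apply: eq_bigr => i _; rewrite coefD scalerDl.
Qed.

Lemma polyopZ z p x : polyop (z *: p) x = z *: polyop p x.
Proof.
rewrite !(@polyop_wide (size p)) ?size_scale_leq// scaler_sumr.
by apply: eq_bigr => i _; rewrite coefZ scalerA.
Qed.

Lemma polyopN p x : polyop (- p) x = - polyop p x.
Proof. by rewrite -scaleN1r polyopZ scaleN1r. Qed.

Lemma polyopB p q x : polyop (p - q) x = polyop p x - polyop q x.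
Proof. by rewrite polyopD polyopN. Qed.

Lemma polyopC z x : polyop z%:P x = z *: x.
Proof. by rewrite (@polyop_wide 1) ?size_polyC_leq1// big_ord1 coefC. Qed.

Lemma polyop1 x : polyop 1 x = x.
Proof. by rewrite polyopC scale1r. Qed.

Lemma polyopMX p x : polyop (p * 'X) x = polyop p (A x).
Proof.
rewrite (@polyop_wide (size p).+1); last first.
  by have := size_polyMleq p 'X; rewrite size_polyX addn2.
rewrite big_ord_recl coefMX scale0r add0r; apply: eq_bigr => i _.
by rewrite coefMX /= -iterSr.
Qed.

Lemma polyopX x : polyop 'X x = A x.
Proof. by rewrite -['X]mul1r polyopMX polyop1. Qed.

Lemma polyopA p x : polyop p (A x) = A (polyop p x).
Proof.
rewrite /polyop linear_sum; apply: eq_bigr => i _.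
by rewrite linearZ /= -iterSr.
Qed.

Lemma polyopM p q x : polyop (p * q) x = polyop p (polyop q x).
Proof.
elim/poly_ind: p x => [|p c IH] x; first by rewrite mul0r !polyopC !scale0r.
rewrite mulrDl !polyopD mul_polyC polyopZ polyopC -mulrA (mulrC 'X) mulrA.
by rewrite !polyopMX IH polyopA.
Qed.

Lemma polyopCA p q x : polyop p (polyop q x) = polyop q (polyop p x).
Proof. by rewrite -!polyopM mulrC. Qed.

(** p splits over [R[i]] into factors X - z, and compositions of onto maps are onto. *)
Lemma polyop_onto p : p != 0 ->
  (forall z, root p z -> forall y, exists x, A x - z *: x = y) ->
  forall y, exists x, polyop p x = y.
Proof.
have [rs ->] := closed_field_poly_normal p.
rewrite scaler_eq0 negb_or lead_coef_eq0 => /andP[p0 _].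
elim: rs => [|z rs IH] pz y.
  exists ((lead_coef p)^-1 *: y).
  by rewrite big_nil polyopZ polyop1 scalerA divff ?scale1r// lead_coef_eq0.
have [|x1 x1E] := IH _ y.
  by move=> w rw; apply: pz; rewrite big_cons scalerAr rootM rw orbT.
have [|x xE] := pz z _ x1.
  by rewrite big_cons scalerAr rootM root_XsubC eqxx.
exists x; rewrite big_cons -x1E -xE scalerAr mulrC polyopM.
by rewrite polyopB polyopX polyopC.
Qed.

(* [dom p q a] says that the "fraction" [(p / q)(A)] has norm at most [a]; all
   computations with such fractions then take place in [{poly R[i]}]. *)
Definition dom p q a := forall x, rnorm (polyop p x) <= a * rnorm (polyop q x).

Lemma dom_refl p : dom p p 1.
Proof. by move=> x; rewrite mul1r. Qed.

Lemma dom_le a b p q : dom p q a -> a <= b -> dom p q b.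
Proof.
by move=> pq ab x; apply: le_trans (pq x) _; rewrite ler_wpM2r ?rnorm_ge0.
Qed.

Lemma domMr u p q a : dom p q a -> dom (p * u) (q * u) a.
Proof. by move=> pq x; rewrite !polyopM. Qed.

Lemma domD p p' q a b : dom p q a -> dom p' q b -> dom (p + p') q (a + b).
Proof.
move=> h h' x; rewrite polyopD mulrDl.
by apply: le_trans (ler_rnormD _ _) _; rewrite lerD.
Qed.

Lemma domZ z p q a : dom p q a -> dom (z *: p) q (rnorm z * a).
Proof.
by move=> h x; rewrite polyopZ rnormZ -mulrA ler_wpM2l ?rnorm_ge0.
Qed.

Lemma domZr (t : R) p q a : 0 <= t -> dom p q a -> dom (t%:C *: p) q (t * a).
Proof. by move=> t0 h; rewrite -[in X in dom _ _ X](ger0_norm t0) -rnormC; exact: domZ. Qed.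

Lemma domN p q a : dom p q a -> dom (- p) q a.
Proof. by move=> h x; rewrite polyopN rnormN. Qed.

Lemma domB p p' q a b : dom p q a -> dom p' q b -> dom (p - p') q (a + b).
Proof. by move=> h h'; apply: domD => //; apply: domN. Qed.

Lemma dom_sum n (F : 'I_n -> {poly R[i]}) q a :
  (forall i, dom (F i) q a) -> dom (\sum_i F i) q (n%:R * a).
Proof.
move=> h x; have -> : polyop (\sum_i F i) x = \sum_i polyop (F i) x.
  by elim/big_rec2: _ => [|i y r _ <-]; rewrite ?polyopC ?scale0r// polyopD.
apply: le_trans (ler_rnorm_sum _ _) _.
apply: (@le_trans _ _ (\sum_(i < n) a * rnorm (polyop q x))).
  by apply: ler_sum => i _; apply: h.
by rewrite sumr_const card_ord -mulrA mulr_natl.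
Qed.

Lemma domM p q p' q' a b : 0 <= a ->
  dom p q a -> dom p' q' b -> dom (p * p') (q * q') (a * b).
Proof.
move=> a0 h h' x; rewrite !polyopM; apply: le_trans (h _) _.
by rewrite -mulrA ler_wpM2l// polyopCA (polyopCA q).
Qed.

(** The common factor cancels because the vectors u(A) x exhaust the space. *)
Lemma dom_cancel u p q a : (forall y, exists x, polyop u x = y) ->
  dom (p * u) (q * u) a -> dom p q a.
Proof.
by move=> hu h y; have [x <-] := hu y; rewrite -!polyopM.
Qed.

(** |p1(A) x| is at most half of |p(A) x| and moves to the left-hand side. *)
Lemma dom_absorb p p1 p2 q a : p = p1 + p2 ->
  dom p1 p 2^-1 -> dom p2 q a -> dom p q (2 * a).
Proof.
move=> pE h1 h2 x; have := h1 x; have := h2 x.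
have := ler_rnormD (polyop p1 x) (polyop p2 x); rewrite -polyopD -pE; lra.
Qed.

End PolynomialCalculus.

(** * Roots of unity and averages *)

Section RootsOfUnity.

(** X^n - 1 is separable in characteristic 0; its n distinct roots include a primitive one. *)
Lemma exists_prim_root (F : numClosedFieldType) n : (0 < n)%N ->
  exists z : F, n.-primitive_root z.
Proof.
move=> n0; have [rs] := closed_field_poly_normal ('X^n - 1 : {poly F}).
rewrite (monicP (monicXnsubC 1 n0)) scale1r => E.
have /hasP[z _ zP] : has n.-primitive_root rs; last by exists z.
apply: has_prim_root => //.
- by apply/allP => z; rewrite -root_prod_XsubC -E.
- by rewrite -separable_prod_XsubC -E separable_Xn_sub_1// pnatr_eq0 -lt0n.
- by rewrite -ltnS -(size_prod_XsubC rs id) -E size_XnsubC.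
Qed.

Context {F : fieldType}.
Implicit Types (z : F) (Y : {poly F}).

Lemma sum_unity_root n z : z ^+ n = 1 ->
  \sum_(j < n) z ^+ j = if z == 1 then n%:R else 0.
Proof.
move=> zn; case: eqP => [->|/eqP z1].
  under eq_bigr do rewrite expr1n.
  by rewrite sumr_const card_ord.
have := subrX1 z n; rewrite zn subrr => /esym/eqP.
by rewrite mulf_eq0 subr_eq0 (negPf z1) => /eqP.
Qed.

(* When [z ^+ n = 1] this is the polynomial [(1 - Y ^+ n) / (1 - z *: Y)]. *)
Definition cofact n z Y : {poly F} := \sum_(m < n) (z *: Y) ^+ m.

Lemma cofactE n z Y : z ^+ n = 1 -> (1 - z *: Y) * cofact n z Y = 1 - Y ^+ n.
Proof.
by move=> zn; rewrite -opprB mulNr -subrX1 exprZn zn scale1r opprB.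
Qed.

(** Discrete Fourier inversion, with z^(n-k) in the role of z^-k: the coefficient of Y^m is a sum of
    powers of z^(n-k+m), which is 0 unless n divides n - k + m. For k, m < n this means m = k. *)
Lemma sum_cofact n z Y k : n.-primitive_root z -> (k < n)%N ->
  \sum_(j < n) (z ^+ j) ^+ (n - k) *: cofact n (z ^+ j) Y = n%:R *: Y ^+ k.
Proof.
move=> zP kn.
have -> : \sum_(j < n) (z ^+ j) ^+ (n - k) *: cofact n (z ^+ j) Y =
    \sum_(m < n) (\sum_(j < n) (z ^+ (n - k + m)) ^+ j) *: Y ^+ m.
  under eq_bigr do rewrite scaler_sumr.
  rewrite exchange_big; apply: eq_bigr => m _ /=; rewrite scaler_suml.
  by apply: eq_bigr => j _; rewrite exprZn scalerA -exprD -!exprM mulnC.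
have zn1 i : (z ^+ i) ^+ n = 1.
  by rewrite -exprM mulnC exprM (prim_expr_order zP) expr1n.
have sumE (m : 'I_n) : \sum_(j < n) (z ^+ (n - k + m)) ^+ j =
    if m == Ordinal kn then n%:R else 0.
  rewrite sum_unity_root// -(prim_order_dvd zP) -val_eqE /=; congr (if _ then _ else _).
  apply/dvdnP/eqP => [[q]|->]; last by exists 1%N; rewrite subnK ?mul1n// ltnW.
  by case: q => [|[|q]]; have := ltn_ord m; lia.
under eq_bigr do rewrite sumE.
by rewrite (bigD1 (Ordinal kn))//= eqxx big1 ?addr0// => m /negPf ->; rewrite scale0r.
Qed.

End RootsOfUnity.

(** * Uniform resolvent bounds on an annulus *)

Section CircleResolvent.
Context {R : realType} {V : normedModType R[i]} (A : {linear V -> V}).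
Context (MA L : R) (MA_gt0 : 0 < MA).
Context (AM : forall x, rnorm (A x) <= MA * rnorm x).
Context (regular : forall w : R[i], L < rnorm w ->
  (exists C, forall x, rnorm x <= C * rnorm (x - w *: A x)) /\
  (forall y, exists x, x - w *: A x = y)).

Lemma rnorm_complex_le (a b : R) : rnorm (a +i* b) <= `|a| + `|b|.
Proof.
have -> : a +i* b = a%:C + 'i * b%:C by rewrite [LHS]complexE -complexiE.
apply: le_trans (ler_rnormD _ _) _; rewrite rnormM !rnormC.
by rewrite /rnorm normCi mul1r.
Qed.

(** Local bounds become uniform by compactness. The compact set is a square; inside the circle of
    radius a the claim is vacuous. *)
Lemma annulus_bound (a b : R) : L < a -> exists2 C : R, 1 <= C &
  forall w, a <= rnorm w <= b -> dom A 1 (1 - w *: 'X) C.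
Proof.
move=> La; pose w (p : R * R) := p.1 +i* p.2.
pose P (C : R) p :=
  a <= rnorm (w p) -> forall x, rnorm x <= C * rnorm (x - w p *: A x).
have w_near p q e : ball p e q -> rnorm (w q - w p) <= 2 * e.
  case: p q => p1 p2 [q1 q2] [] /=; rewrite -!ball_normE /ball_ /= => h1 h2.
  apply: le_trans (rnorm_complex_le _ _) _.
  by rewrite distrC (distrC q2); rewrite mulrDl mul1r lerD// ltW.
have /compact_near_coveringP/(_ R +oo P _) cov :
    compact (`[- b, b] `*` `[- b, b] : set (R * R)).
  by apply: compact_setX; apply: segment_compact.
have [p _|C0 [_ PC]] := cov.
  case: (ltP (rnorm (w p)) a) => [wa|aw].
    (* Points this close to p stay inside the circle, where [P] is vacuous. *)
    pose e := (a - rnorm (w p)) / 4.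
    exists (ball p e, setT).
      by split; [apply: nbhsx_ballx; rewrite divr_gt0 ?subr_gt0 | exact: filterT].
    move=> [q C] /= [/w_near wq _] aq.
    have := ler_rnormD (w q - w p) (w p); rewrite subrK; rewrite /e in wq.
    lra.
  have [[C CP] _] := regular (lt_le_trans La aw).
  have [D D1 DP] : exists2 D : R, 1 <= D &
      forall x, rnorm x <= D * rnorm (x - w p *: A x).
    exists (Num.max C 1) => [|x]; first by rewrite le_max lexx orbT.
    apply: le_trans (CP x) _.
    by rewrite ler_wpM2r ?rnorm_ge0// le_max lexx.
  have D0 : 0 < D by lra.
  (* Within the ball w moves by at most 2 e, which costs D * 2 e * MA = 1/2 of |x|; the bound D at p
     becomes 2 D nearby. *)
  pose e := (4 * D * MA)^-1.
  have e0 : 0 < e by rewrite invr_gt0 !mulr_gt0.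
  exists (ball p e, [set C | 2 * D <= C]).
    by split; [exact: nbhsx_ballx | exact: nbhs_pinfty_ge (num_real _)].
  move=> [q C'] /= [/w_near wq C'D] _ x.
  have DeM : 2 * e * MA * D = 2^-1 by rewrite /e; field; rewrite (gt_eqF D0) (gt_eqF MA_gt0).
  have h1 : rnorm ((w q - w p) *: A x) <= 2 * e * MA * rnorm x.
    rewrite rnormZ -mulrA; apply: ler_pM => //; exact: rnorm_ge0.
  have h2 : rnorm (x - w p *: A x) <=
      rnorm (x - w q *: A x) + rnorm ((w q - w p) *: A x).
    by apply: le_trans (ler_rnormD _ _); rewrite scalerBl addrA subrK.
  have h3 := DP x.
  have h4 : 2 * D * rnorm (x - w q *: A x) <= C' * rnorm (x - w q *: A x).
    by rewrite ler_wpM2r ?rnorm_ge0.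
  have h5 : D * rnorm (x - w p *: A x) <=
    D * (rnorm (x - w q *: A x) + 2 * e * MA * rnorm x).
    rewrite ler_wpM2l ?(ltW D0)//; lra.
  have h6 : D * (2 * e * MA * rnorm x) = 2^-1 * rnorm x by rewrite mulrA (mulrC D) DeM.
  rewrite mulrDr h6 in h5; lra.
have [C [C1 C0C]] : exists C, 1 <= C /\ C0 < C.
  exists (Num.max C0 0 + 1); split; first by rewrite lerDr le_max lexx orbT.
  by rewrite (@le_lt_trans _ _ (Num.max C0 0)) ?ltrDl// le_max lexx.
exists C => // z /andP[az zb] x.
rewrite polyop1 polyopB polyop1 polyopZ polyopX.
have zE : w (complex.Re z, complex.Im z) = z by rewrite /w; case: z {az zb}.
have := PC C C0C (complex.Re z, complex.Im z).
rewrite /P zE; apply=> //.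
have hRe : `|complex.Re z| <= b.
  by rewrite -lecR (le_trans (normc_ge_Re _))// normE lecR.
have hIm : `|complex.Im z| <= b.
  rewrite -normrN -ReiNIm -lecR (le_trans (normc_ge_Re _))// normrM.
  by rewrite complexiE normCi mulr1 normE lecR.
by split; rewrite /= in_itv /= -ler_norml.
Qed.

End CircleResolvent.

(* For [N] large [(pole rho N)(A)^-1] approximates the Riesz projection of [A]
   onto the part of the spectrum inside the circle of radius [rho^-1]. *)
Definition pole {R : realType} (rho : R) N : {poly R[i]} :=
  1 - (rho%:C *: 'X) ^+ N.

(** * Averages of resolvents over roots of unity *)

Section PoleBounds.
Context {R : realType} {V : normedModType R[i]} (A : {linear V -> V}).
Context (a b C : R) (a_gt0 : 0 < a) (C_ge1 : 1 <= C).
Context (circle : forall w, a <= rnorm w <= b -> dom A 1 (1 - w *: 'X) C).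
Implicit Types rho sigma : R.

Let C_ge0 : 0 <= C. Proof. exact: le_trans C_ge1. Qed.

Lemma rnorm_unity_root N (z : R[i]) : (0 < N)%N -> z ^+ N = 1 -> rnorm z = 1.
Proof.
move=> N0 zN; apply/eqP; rewrite -(@pexpr_eq1 _ _ N) ?rnorm_ge0//.
by rewrite -rnormX zN rnorm1.
Qed.

Lemma cofact_pole N (z : R[i]) rho : z ^+ N = 1 ->
  (1 - (z * rho%:C) *: 'X) * cofact N z (rho%:C *: 'X) = pole rho N.
Proof. by move=> zN; rewrite -scalerA cofactE. Qed.

(** By [cofact_pole] the fraction is 1 / (1 - z rho X), a resolvent at a point of the circle of
    radius rho. *)
Lemma cofact_dom N (z : R[i]) rho : (0 < N)%N -> z ^+ N = 1 -> a <= rho <= b ->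
  dom A (cofact N z (rho%:C *: 'X)) (pole rho N) C.
Proof.
move=> N0 zN rhoab; rewrite -(cofact_pole _ zN) -[X in dom _ X]mul1r.
apply: domMr; apply: circle; rewrite rnormM (rnorm_unity_root N0 zN) mul1r.
by rewrite rnormC ger0_norm//; case/andP: rhoab => ar _; rewrite (le_trans _ ar)// ltW.
Qed.

Lemma mean_dom N (F : 'I_N -> {poly R[i]}) p q e : (0 < N)%N ->
  N%:R *: p = \sum_i F i -> (forall i, dom A (F i) q e) -> dom A p q e.
Proof.
move=> N0 pE Fq; have NN0 : N%:R != 0 :> R[i] by rewrite pnatr_eq0 -lt0n.
have -> : p = N%:R^-1 *: \sum_i F i by rewrite -pE scalerA mulVf// scale1r.
have -> : e = rnorm (N%:R^-1 : R[i]) * (N%:R * e).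
  rewrite rnormV -(rmorph_nat (real_complex R)) rnormC normr_nat mulrA mulVf ?mul1r//.
  by rewrite pnatr_eq0 -lt0n.
by apply: domZ; apply: dom_sum.
Qed.

(** By [sum_cofact] the fraction is a mean of unimodular multiples of resolvents, so it inherits
    their bound C, uniformly in N. *)
Lemma power_pole_dom N k rho : (k < N)%N -> a <= rho <= b ->
  dom A ((rho%:C *: 'X) ^+ k) (pole rho N) C.
Proof.
move=> kN rhoab; have N0 : (0 < N)%N by apply: leq_trans kN.
have [z zP] := @exists_prim_root R[i] N N0.
have zj i : (z ^+ i) ^+ N = 1.
  by rewrite -exprM mulnC exprM (prim_expr_order zP) expr1n.
apply: (@mean_dom N _ _ _ _ N0 (esym (sum_cofact _ zP kN))) => j.
rewrite -[C]mul1r -(rnorm_unity_root N0 (zj (j * (N - k))%N)) exprM.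
by apply: domZ; apply: cofact_dom.
Qed.

Lemma pole_dom N rho : (0 < N)%N -> a <= rho <= b -> dom A 1 (pole rho N) C.
Proof. exact: power_pole_dom. Qed.

Lemma powerN_pole_dom N rho : (0 < N)%N -> a <= rho <= b ->
  dom A ((rho%:C *: 'X) ^+ N) (pole rho N) (C + 1).
Proof.
move=> N0 rhoab.
have -> : (rho%:C *: 'X) ^+ N = 1 - pole rho N by rewrite /pole; ring.
by apply: domB; [exact: pole_dom | exact: dom_refl].
Qed.

(** The fraction is 1 / pole sigma - 1 / pole rho, a mean of resolvent differences. With R_t = 1 /
    (1 - z t X), the resolvent identity makes each of them (sigma - rho) / rho times R_sigma (R_rho
    - 1). The bound does not depend on N. *)
Lemma pole_lipschitz N rho sigma : (0 < N)%N -> a <= rho <= b -> a <= sigma <= b ->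
  dom A (pole rho N - pole sigma N) (pole sigma N * pole rho N)
    (`|(sigma - rho) / rho| * (C * (C + 1))).
Proof.
move=> N0 rhoab sigmaab; have [z zP] := @exists_prim_root R[i] N N0.
have rho0 : 0 < rho by case/andP: rhoab => + _; exact: lt_le_trans.
have zj i : (z ^+ i) ^+ N = 1.
  by rewrite -exprM mulnC exprM (prim_expr_order zP) expr1n.
have sumQ (t : R) : \sum_(j < N) cofact N (z ^+ j) (t%:C *: 'X) = N%:R%:P.
  have := sum_cofact (t%:C *: 'X) zP N0; rewrite subn0 expr0 -mul_polyC mulr1 => <-.
  by apply: eq_bigr => j _; rewrite zj scale1r.
pose F (j : 'I_N) := ((sigma - rho) / rho)%:C *:
  (cofact N (z ^+ j) (sigma%:C *: 'X) *
    (cofact N (z ^+ j) (rho%:C *: 'X) - pole rho N)).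
apply: (@mean_dom N F) => // [|j]; last first.
  rewrite -rnormC; apply: domZ; apply: domM => //; first exact: cofact_dom.
  by apply: domB; [exact: cofact_dom | exact: dom_refl].
rewrite -mul_polyC mulrBr -[in X in X * pole rho N](sumQ sigma) -(sumQ rho).
rewrite !mulr_suml -sumrB; apply: eq_bigr => j _; rewrite /F.
rewrite -!(cofact_pole _ (zj j)) -!mul_polyC.
have E : (sigma - rho) = (sigma - rho) / rho * rho by rewrite divfK ?gt_eqF.
have -> : (z ^+ j * sigma%:C)%:P =
  (z ^+ j)%:P * (rho%:C%:P + ((sigma - rho) / rho)%:C%:P * rho%:C%:P).
  by rewrite -!polyCM -polyCD -polyCM -!rmorphM -rmorphD /= -E addrC subrK.
rewrite polyCM; ring.
Qed.

End PoleBounds.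

Lemma polyop_onto_mul {R : realType} {V : normedModType R[i]}
    (A : {linear V -> V}) (p q : {poly R[i]}) :
  (forall y, exists x, polyop A p x = y) ->
  (forall y, exists x, polyop A q x = y) ->
  forall y, exists x, polyop A (p * q) x = y.
Proof.
move=> hp hq y; have [x <-] := hp y; have [x' <-] := hq x.
by exists x'; rewrite polyopM.
Qed.

Lemma mul_polyCVK {R : realType} (s t : R) (p : {poly R[i]}) :
  s * t = 1 -> s%:C%:P * (t%:C%:P * p) = p.
Proof. by move=> st; rewrite mulrA -polyCM -rmorphM /= st !rmorph1 mul1r. Qed.

(** * Comparison of approximate projections for different circles *)

Section PoleStability.
Context {R : realType} {V : normedModType R[i]} (A : {linear V -> V}).
Context (a b C : R) (a_gt0 : 0 < a) (C_ge1 : 1 <= C).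
Context (circle : forall w, a <= rnorm w <= b -> dom A 1 (1 - w *: 'X) C).
Context (onto : forall rho N, a <= rho -> (0 < N)%N ->
  forall y, exists x, polyop A (pole rho N) x = y).
Context (k : R) (k_gt1 : 1 < k) (k_le : C * (C + 1) * (k ^+ 3 - 1) <= 4^-1).
Context (N : nat) (N_gt0 : (0 < N)%N) (kN_ge2 : 2 <= k ^+ N).
Implicit Types rho : R.

Let k_gt0 : 0 < k. Proof. exact: lt_trans k_gt1. Qed.

Let ak rho n : a <= rho -> a <= k ^+ n * rho.
Proof.
move=> ar; apply: (le_trans ar); rewrite ler_peMl ?exprn_ege1 ?ltW//.
exact: lt_le_trans ar.
Qed.

Let kb rho n m :
  a <= rho -> (n <= m)%N -> k ^+ m * rho <= b -> k ^+ n * rho <= b.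
Proof.
move=> ar nm; apply: le_trans; rewrite ler_wpM2r ?ler_weXn2l ?ltW//.
exact: lt_le_trans ar.
Qed.

Let powerk rho n :
  ((k ^+ n * rho)%:C *: 'X) ^+ N = ((k ^+ N) ^+ n)%:C%:P * (rho%:C *: 'X) ^+ N.
Proof.
by rewrite mul_polyC rmorphM /= -scalerA exprZn -exprM mulnC exprM -!rmorphXn.
Qed.

(* Write [E_i] for the approximate projections of the circles [k ^+ i * rho].
   Up to geometrically small errors [(1 - E_3) E_0] acts as the identity on the
   range of [(1 - E_2) E_1]; as the four circles are close to each other, its
   norm is at most [2^-1], hence [(1 - E_2) E_1] is small. *)
Lemma pole_step rho : a <= rho -> k ^+ 3 * rho <= b ->
  dom A (pole (k * rho) N - pole (k ^+ 2 * rho) N)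
    (pole (k * rho) N * pole (k ^+ 2 * rho) N) (4 * (C + 1) ^+ 4 / k ^+ N).
Proof.
move=> ar rb; have C0 : 0 <= C by apply: le_trans C_ge1.
have rho0 : 0 < rho by exact: lt_le_trans ar.
pose K := k ^+ N; have K0 : 0 < K by rewrite exprn_gt0.
have ab n : (n <= 3)%N -> a <= k ^+ n * rho <= b.
  by move=> n3; rewrite ak// (kb ar n3).
pose y n := ((k ^+ n * rho)%:C *: 'X) ^+ N; pose c n := pole (k ^+ n * rho) N.
have cE n : c n = 1 - y n by [].
have cdom n : (n <= 3)%N -> dom A 1 (c n) C.
  by move=> n3; exact: pole_dom (ab n n3).
have ydom n : (n <= 3)%N -> dom A (y n) (c n) (C + 1).
  by move=> n3; exact: powerN_pole_dom (ab n n3).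
have yE n : y n.+1 = K%:C%:P * y n.
  by rewrite /y !powerk mulrA -polyCM -rmorphM -exprS.
(* t = k^-N is the ratio of consecutive [y n] and the source of all smallness. *)
pose t := K^-1.
have yV n : y n = t%:C%:P * y n.+1.
  by rewrite yE mul_polyCVK// mulVf ?gt_eqF.
have t_gt0 : 0 < t by rewrite invr_gt0.
have t_le : t <= 2^-1 by rewrite lef_pV2// posrE.
(* Since c 0 - c 3 = (1 - t^3) y 3, [pole_lipschitz] applies to the circles rho and k^3 rho; its
   bound is at most 1/4 by [k_le], and 1 - t^3 >= 1/2. *)
have h03 : dom A (y 3%N) (c 3%N * c 0%N) 2^-1.
  have K3 : 0 < 1 - t ^+ 3.
    have := mulr_ge0 (ltW t_gt0) (ltW t_gt0); rewrite !exprS expr0; nra.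
  have -> : y 3%N = ((1 - t ^+ 3)^-1)%:C *: (c 0%N - c 3%N).
    rewrite -mul_polyC !cE (yV 0%N) (yV 1%N) (yV 2%N).
    have -> : 1 - t%:C%:P * (t%:C%:P * (t%:C%:P * y 3%N)) - (1 - y 3%N) =
        (1 - t ^+ 3)%:C%:P * y 3%N.
      by rewrite !rmorphB !rmorph1 !rmorphXn /=; ring.
    by rewrite mul_polyCVK// mulVf ?gt_eqF.
  apply: dom_le; first by apply: (domZr (ltW _)); rewrite ?invr_gt0//;
    apply: (pole_lipschitz a_gt0 C_ge1 circle) => //; exact: ab.
  have -> : (k ^+ 3 * rho - k ^+ 0 * rho) / (k ^+ 0 * rho) = k ^+ 3 - 1.
    by rewrite expr0; field; rewrite gt_eqF.
  have k3 : 0 <= k ^+ 3 - 1 by rewrite subr_ge0 exprn_ege1// ltW.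
  rewrite ger0_norm// mulrC ler_pdivrMr// mulrC.
  have : t ^+ 3 <= 2^-1 by rewrite (le_trans _ t_le)// ler_iXnr// ltW//; lra.
  move: k_le; nra.
have main : dom A (y 2%N) (c 1%N * c 2%N) (4 * (C + 1) ^+ 4 * t).
  apply: (@dom_cancel _ _ _ (c 3%N * c 0%N)).
    by apply: polyop_onto_mul; apply: onto => //; apply: ak.
  (* The first summand is at most half of the left-hand side by [h03]; the other two carry a factor
     t, as y 2 = t y 3 and y 0 = t y 1. *)
  have pE : y 2%N * (c 3%N * c 0%N) =
      - (y 3%N * y 2%N) + (y 2%N * c 0%N + y 0%N * y 2%N * y 3%N).
    by rewrite !cE; ring.
  have -> : 4 * (C + 1) ^+ 4 * t = 2 * (2 * (C + 1) ^+ 4 * t) by ring.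
  apply: (dom_absorb pE).
    by rewrite -mulNr [y 2%N * _]mulrC; apply: domMr; apply: domN.
  apply: (@dom_le _ _ _ (t * ((C + 1) * C * C * 1) +
                          t * ((C + 1) * (C + 1) * (C + 1) * C))).
    apply: domD.
    (* The factors 1 are paired with the denominators [c 1] and [c 2]. *)
    - have -> : y 2%N * c 0%N = t%:C *: (y 3%N * 1 * 1 * c 0%N).
        by rewrite (yV 2%N) -mul_polyC; ring.
      have -> : c 1%N * c 2%N * (c 3%N * c 0%N) =
          c 3%N * c 1%N * c 2%N * c 0%N by ring.
      apply: domZr; first exact: ltW.
      do !apply: domM; rewrite ?mulr_ge0 ?addr_ge0//;
        [exact: ydom|exact: cdom|exact: cdom|exact: dom_refl].
    - have -> : y 0%N * y 2%N * y 3%N = t%:C *: (y 1%N * y 2%N * y 3%N * 1).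
        by rewrite (yV 0%N) -mul_polyC; ring.
      have -> : c 1%N * c 2%N * (c 3%N * c 0%N) =
          c 1%N * c 2%N * c 3%N * c 0%N by ring.
      apply: domZr; first exact: ltW.
      do !apply: domM; rewrite ?mulr_ge0 ?addr_ge0//;
        [exact: ydom|exact: ydom|exact: ydom|exact: cdom].
  rewrite [leRHS]mulrC -mulrDr ler_wpM2l ?(ltW t_gt0)//.
  move: C_ge1; rewrite !exprS expr0; nra.
have -> : pole (k * rho) N - pole (k ^+ 2 * rho) N = (1 - t)%:C *: y 2%N.
  rewrite -/(c 1%N) -/(c 2%N) !cE (yV 1%N) -mul_polyC !rmorphB !rmorph1 /=; ring.
apply: dom_le; first by apply: domZr; [lra | exact: main].
rewrite ler_piMl ?mulr_ge0 ?exprn_ge0 ?addr_ge0 ?(ltW t_gt0)//; lra.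
Qed.

(** Telescoping over n pairs of neighbouring circles. [pole_step] needs one more circle on either
    side, whence k * a <= rho and the exponent n.+1. *)
Lemma pole_chain rho n : k * a <= rho -> k ^+ n.+1 * rho <= b ->
  dom A (pole rho N - pole (k ^+ n * rho) N) (pole rho N * pole (k ^+ n * rho) N)
    (n%:R * (4 * (C + 1) ^+ 4 / k ^+ N)).
Proof.
move=> ar; set e := 4 * _ / _.
have ak' : a <= rho by rewrite (le_trans _ ar)// ler_peMl// ltW.
elim: n => [_|n IH rb].
  by rewrite expr0 mul1r subrr mul0r => x; rewrite polyopC scale0r rnorm0 mul0r.
set r := pole rho N; set t := pole (k ^+ n.+1 * rho) N.
pose s := pole (k ^+ n * rho) N.
have h1 : dom A (r - s) (r * s) (n%:R * e) by apply: IH; exact: kb rb.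
have h2 : dom A (s - t) (s * t) e.
  have kr : k^-1 * rho >= a by rewrite ler_pdivlMl.
  have k0 : k != 0 by rewrite gt_eqF.
  have e1 : k * (k ^+ n * (k^-1 * rho)) = k ^+ n * rho by field.
  have e2 : k ^+ 2 * (k ^+ n * (k^-1 * rho)) = k ^+ n.+1 * rho.
    by rewrite !exprS; field.
  have := @pole_step (k ^+ n * (k^-1 * rho)); rewrite e1 e2; apply; first exact: ak.
  have -> // : k ^+ 3 * (k ^+ n * (k^-1 * rho)) = k ^+ n.+2 * rho.
  by rewrite !exprS; field.
apply: (@dom_cancel _ _ _ s); first by apply: onto => //; exact: ak.
have -> : (r - t) * s = (r - s) * t + (s - t) * r by ring.
have -> : n.+1%:R * e = n%:R * e + e by rewrite -natr1 mulrDl mul1r.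
apply: domD.
  by rewrite [r * t * s]mulrAC; exact: domMr.
by rewrite -[r * t * s]mulrA [t * s]mulrC [r * _]mulrC; exact: domMr.
Qed.
End PoleStability.

Lemma expr_near_lt {R : realType} (q e : R) : 0 <= q < 1 -> 0 < e ->
  \forall n \near \oo, q ^+ n < e.
Proof.
move=> /andP[q0 q1] e0; have := @cvg_expr R q; rewrite ger0_norm// => /(_ q1) h.
exact: (cvgr_lt 0 h).
Qed.

(** A root z of [pole rho N] has modulus rho^-1, so 1/z lies on the circle of radius rho, and A - z
    = - z (1 - A / z). *)
Lemma pole_onto {R : realType} {V : normedModType R[i]} (A : {linear V -> V})
    (rho : R) N : 0 < rho -> (0 < N)%N ->
  (forall w, rnorm w = rho -> forall y, exists x, x - w *: A x = y) ->
  forall y, exists x, polyop A (pole rho N) x = y.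
Proof.
move=> rho0 N0 solve; have poleE z : (pole rho N).[z] = 1 - (rho%:C * z) ^+ N.
  by rewrite /pole !hornerE.
apply: polyop_onto => [|z].
  apply/eqP => e; have := poleE 0; rewrite e horner0 mulr0 expr0n gtn_eqF//= subr0.
  by move/eqP; rewrite eq_sym oner_eq0.
rewrite /root poleE subr_eq0 eq_sym => /eqP zN y.
have rz : rho * rnorm z = 1.
  by rewrite -(rnorm_unity_root N0 zN) rnormM rnormC gtr0_norm.
have z0 : z != 0.
  by apply/eqP => e; move/eqP: rz; rewrite e rnorm0 mulr0 eq_sym oner_eq0.
have [|x xE] := solve z^-1 _ (- z^-1 *: y).
  by rewrite rnormV; apply: invr_inj; rewrite invrK; apply: (mulfI (lt0r_neq0 rho0));
    rewrite rz divff ?gt_eqF.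
exists x; apply: (scalerI (invr_neq0 z0)); apply: oppr_inj.
by rewrite -[RHS]scaleNr -xE scalerBr scalerA mulVf// scale1r opprB.
Qed.

(** * Powers of a paranormal operator *)

Section Paranormal.
Context {R : realType} {V : normedModType R[i]} (A : {linear V -> V}).
Context (par : forall x, rnorm (A x) ^+ 2 <= rnorm (A (A x)) * rnorm x).

(** The ratios |A^(n+1) x| / |A^n x| are nondecreasing in n, so each is at least the first. *)
Lemma paranormal_ratio n x :
  rnorm (A x) * rnorm (iter n A x) <= rnorm (iter n.+1 A x) * rnorm x.
Proof.
elim: n => [|n IH]//=.
have [z0|nz] := eqVneq (iter n A x) 0.
  by rewrite z0 !linear0 rnorm0 mulr0 mul0r.
have a0 : 0 < rnorm (iter n A x) by rewrite rnorm_gt0.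
rewrite -(ler_pM2r a0); move: IH (par (iter n A x)) => /=.
move: (rnorm_ge0 (A x)) (rnorm_ge0 x) (rnorm_ge0 (A (iter n A x))).
set u := rnorm (A x); set v := rnorm x; set s := rnorm (iter n A x).
set s1 := rnorm (A (iter n A x)); set s2 := rnorm _ => u0 v0 s10 h1 h2.
have := ler_wpM2l s10 h1; have := ler_wpM2r v0 h2; lra.
Qed.

Lemma paranormal_power n x :
  rnorm (A x) ^+ n.+1 <= rnorm (iter n.+1 A x) * rnorm x ^+ n.
Proof.
elim: n => [|n IH]; first by rewrite expr0 mulr1 expr1.
rewrite exprS; apply: le_trans (ler_wpM2l (rnorm_ge0 _) IH) _.
rewrite mulrA exprS mulrA ler_wpM2r ?exprn_ge0 ?rnorm_ge0//.
exact: paranormal_ratio.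
Qed.

End Paranormal.

(** * The isolated spectral point 0 *)

Section IsolatedSpectrum.
Context {R : realType} {V : normedModType R[i]} (A : {linear V -> V}).
Context (MA L : R) (MA_gt0 : 0 < MA).
Context (AM : forall x, rnorm (A x) <= MA * rnorm x).
Context (L_ge0 : 0 <= L).
Context (regular : forall w : R[i], L < rnorm w ->
  (exists C, forall x, rnorm x <= C * rnorm (x - w *: A x)) /\
  (forall y, exists x, x - w *: A x = y)).
Context (par : forall x, rnorm (A x) ^+ 2 <= rnorm (A (A x)) * rnorm x).

Lemma polyopXn n x : polyop A 'X^n x = iter n A x.
Proof.
elim: n x => [|n IH] x; first by rewrite polyop1.
by rewrite exprSr polyopMX IH -iterSr.
Qed.

(* On the range of [(pole sigma N)(A)^-1] the [N]-th powers of [A] are bounded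
   by those of the radius [sigma^-1], and so is [A] by paranormality. *)
Lemma pole_small_radius (C sigma : R) N y : 0 < sigma -> 1 <= C -> C <= 2 ^+ N.+1 ->
  dom A ((sigma%:C *: 'X) ^+ N.+1) (pole sigma N.+1) C ->
  forall m, rnorm y <= m -> rnorm (polyop A (pole sigma N.+1) y) <= m ->
  sigma * rnorm (A y) <= 2 * m.
Proof.
move=> s0 C1 C2 /(_ y) pdom m ym xm; rewrite leNgt; apply/negP => lt_m.
have m0 : 0 <= m by exact: le_trans (rnorm_ge0 _) ym.
have h1 : (2 * m) ^+ N.+1 < (sigma * rnorm (A y)) ^+ N.+1.
  by rewrite ltrXn2r// mulr_ge0.
(* This contradicts [h1] because C <= 2^(N+1), that is, the (N+1)-th root of C is at most 2. *)
have h2 : (sigma * rnorm (A y)) ^+ N.+1 <= C * m ^+ N.+1.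
  rewrite exprMn.
  apply: (@le_trans _ _ (sigma ^+ N.+1 * rnorm (iter N.+1 A y) * rnorm y ^+ N)).
    by rewrite -mulrA ler_wpM2l ?exprn_ge0 ?(ltW s0)// paranormal_power.
  rewrite [m ^+ _]exprS mulrA; apply: ler_pM.
  - by rewrite mulr_ge0 ?exprn_ge0 ?rnorm_ge0 ?(ltW s0).
  - by rewrite exprn_ge0 ?rnorm_ge0.
  - have : sigma ^+ N.+1 * rnorm (iter N.+1 A y) =
      rnorm (polyop A ((sigma%:C *: 'X) ^+ N.+1) y).
      by rewrite exprZn polyopZ polyopXn rnormZ rnormX rnormC ger0_norm// ltW.
    move=> ->; apply: le_trans pdom _; rewrite ler_wpM2l//; lra.
  - by rewrite lerXn2r ?nnegrE ?rnorm_ge0.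
have := le_lt_trans _ (lt_le_trans h1 h2); rewrite exprMn => /(_ (C * m ^+ N.+1)).
by rewrite ltxx ler_wpM2r ?exprn_ge0// => /(_ isT).
Qed.

(** [rho] and [C0] are fixed before eta. A is small on the approximate projection for a large sigma,
    and [pole_chain] carries this over to rho. *)
Lemma pole_concentration : exists rho C0 : R, [/\ 0 < rho, 1 <= C0 &
  forall eta, 0 < eta -> exists N, [/\ dom A 'X (pole rho N.+1) eta,
    dom A ((rho%:C *: 'X) ^+ N) (pole rho N.+1) C0 &
    forall y, exists x, polyop A (pole rho N.+1) x = y]].
Proof.
(* The factor 4 leaves room below rho for the extra circle in [pole_chain], as k <= 2. *)
pose a := L + 1; pose rho := 4 * a.
have a0 : 0 < a by rewrite ltr_wpDl.
have La : L < a by rewrite ltrDl.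
have rho0 : 0 < rho by rewrite mulr_gt0.
have arho : a <= rho by rewrite ler_peMl ?ltW//; lra.
have [C0 C0_ge1 circ0] := annulus_bound MA_gt0 AM regular rho La.
exists rho, C0; split=> // eta eta0.
(* Once sigma >= S, the factor 2 (C0 + 1) / sigma is at most eta / 2. The annulus reaches 4 S
   because sigma <= 2 S and one more factor k <= 2 occurs. *)
pose S := 4 * (C0 + 1) / eta + rho; pose b := 4 * S.
have S_rho : rho <= S by rewrite lerDr divr_ge0 ?mulr_ge0//; lra.
have S_eta : 4 * (C0 + 1) <= S * eta.
  have -> : S * eta = 4 * (C0 + 1) + rho * eta by rewrite /S; field; rewrite gt_eqF.
  by rewrite lerDl mulr_ge0 ?ltW.
have [C C1 circ] := annulus_bound MA_gt0 AM regular b La.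
have [k k1 [k2 kC]] : exists2 k : R, 1 < k & k <= 2 /\ C * (C + 1) * (k ^+ 3 - 1) <= 4^-1.
  (* For d <= 1 one has (1 + d)^3 - 1 <= 7 d, and 7 / 28 = 1 / 4. *)
  have D0 : 0 < 28 * (C * (C + 1)) by rewrite !mulr_gt0//; lra.
  have [d [d0 d1 dC]] : exists d, [/\ 0 < d, d <= 1 & C * (C + 1) * d = 28^-1].
    exists (28 * (C * (C + 1)))^-1; split; first by rewrite invr_gt0.
      by rewrite invf_le1//; move: C1; nra.
    by field; rewrite !gt_eqF//; lra.
  exists (1 + d); first by rewrite ltrDl.
  split; first by rewrite lerD2l.
  have -> : C * (C + 1) * ((1 + d) ^+ 3 - 1) = C * (C + 1) * d * (3 + 3 * d + d ^+ 2).
    by ring.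
  by rewrite dC; nra.
have k0 : 0 < k by lra.
have onto t N : a <= t -> (0 < N)%N -> forall y, exists x, polyop A (pole t N) x = y.
  move=> at_ N0; apply: pole_onto => //; first exact: lt_le_trans at_.
  by move=> w wt; apply: (regular _).2; rewrite wt (lt_le_trans La).
have kV e : 0 < e -> \forall n \near \oo, (k^-1) ^+ n < e.
  by move=> e0; apply: expr_near_lt; rewrite // invr_ge0 ltW//= invf_lt1.
(* m is the least exponent reaching S; as k <= 2, it overshoots by at most a factor 2. *)
have [m Sm mS] : exists2 m, S <= k ^+ m * rho & k ^+ m * rho <= 2 * S.
  have S0 : 0 < S by exact: lt_le_trans S_rho.
  have exm : exists n, S <= k ^+ n * rho.
    have [n /= nP] := filter_ex (kV _ (divr_gt0 rho0 S0)); exists n.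
    by move: nP; rewrite ltr_pdivlMr// exprVn mulrC ltr_pdivrMr ?exprn_gt0// mulrC => /ltW.
  case: (ex_minnP exm) => n nP nmin; exists n => //.
  case: n nP nmin => [|n] _ nmin; first by rewrite expr0; lra.
  have : ~~ (S <= k ^+ n * rho) by apply/negP => /nmin; rewrite ltnn.
  rewrite -ltNge exprS -mulrA => /ltW lS; apply: ler_pM => //; first lra.
  by rewrite mulr_ge0 ?exprn_ge0 ?ltW.
(* The first bound on [eps] serves to control |y|, the second |A (y - z)|. *)
pose eps := Num.min 1 (eta / (2 * MA)).
have eps0 : 0 < eps by rewrite lt_min ltr01 divr_gt0// mulr_gt0.
(* N is chosen after m: it must beat the m accumulated errors and make the (N+1)-th root of C + 1 at
   most 2. *)
have [N [N2 Neps NC]] : exists N, [/\ 2 <= k ^+ N.+1,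
    m%:R * (4 * (C + 1) ^+ 4 / k ^+ N.+1) <= eps & C + 1 <= 2 ^+ N.+1].
  pose E := m%:R * (4 * (C + 1) ^+ 4).
  have E0 : 0 <= E by rewrite !mulr_ge0 ?exprn_ge0 ?ler0n//; lra.
  have E1 : 0 < E + 1 by rewrite ltr_wpDl.
  have C10 : 0 < C + 1 by lra.
  have n2 := kV _ (divr_gt0 eps0 E1).
  have half0 : 0 < (2^-1 : R) by rewrite invr_gt0.
  have half : 0 <= (2^-1 : R) < 1 by lra.
  have C1V : 0 < (C + 1)^-1 by rewrite invr_gt0.
  have n3 := expr_near_lt half C1V.
  have [[|N] [n0 [h1 [h2 h3]]]] := filter_ex (filterI (nbhs_infty_gt 0)
    (filterI (kV _ half0) (filterI n2 n3))) => //.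
  exists N; have kN : 0 < k ^+ N.+1 by rewrite exprn_gt0.
  split.
  - by rewrite -lef_pV2 ?posrE// -exprVn ltW.
  - move: h2; rewrite /= exprVn ltr_pdivlMr// mulrDr mulr1 mulrA -/E => h2.
    have := invr_gt0 (k ^+ N.+1); rewrite kN [E / _]mulrC; lra.
  - by rewrite -lef_pV2 ?posrE ?exprn_gt0// -exprVn ltW.
exists N; split; last 1 first.
- exact: onto.
- pose sigma := k ^+ m * rho; pose r := pole rho N.+1; pose s := pole sigma N.+1.
  have sigma0 : 0 < sigma by apply: lt_le_trans Sm; apply: lt_le_trans S_rho.
  have asigma : a <= sigma by apply: le_trans arho (le_trans S_rho Sm).
  have S_gt0 : 0 < S by exact: lt_le_trans S_rho.
  have sigmab : sigma <= b.
    by apply: le_trans mS _; rewrite ler_wpM2r ?(ltW S_gt0)// ler_nat.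
  have chain : dom A (r - s) (r * s) eps.
    apply: dom_le Neps; apply: (pole_chain a0 C1 circ) => //.
    - by rewrite /rho ler_wpM2r ?(ltW a0)//; lra.
    - rewrite exprS -mulrA; have -> : b = 2 * (2 * S) by rewrite /b; ring.
      by apply: ler_pM => //; [exact: ltW | exact: ltW].
  apply: (@dom_cancel _ _ _ s); first exact: onto.
  move=> v; rewrite polyopM polyopX.
  set x := rnorm (polyop A (r * s) v).
  have x0 : 0 <= x by exact: rnorm_ge0.
  (* For u = (r s)(A) v these are y = s(A)^-1 u and z = r(A)^-1 u, the approximate projections of u
     for sigma and rho. *)
  pose y := polyop A r v; pose z := polyop A s v.
  have yz : rnorm (y - z) <= eps * x by rewrite -polyopB; exact: chain.
  have zx : rnorm z <= C0 * x.
    have := pole_dom a0 circ0 (N := N.+1) (rho := rho) isT.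
    rewrite arho lexx => /(_ isT) /(domMr s) /(_ v); rewrite mul1r; exact.
  have eps1 : eps <= 1 by rewrite ge_min lexx.
  have yx : rnorm y <= (C0 + 1) * x.
    have := ler_rnormD (y - z) z; rewrite subrK.
    by move: yz zx eps1 x0; clear; nra.
  have Ay : sigma * rnorm (A y) <= 2 * ((C0 + 1) * x).
    apply: (@pole_small_radius (C + 1) sigma N) => //; first by lra.
    - by apply: (powerN_pole_dom a0 circ) => //; rewrite asigma.
    - by rewrite /y -polyopM mulrC -/x ler_peMl//; lra.
  have Az : rnorm (A z) <= rnorm (A y) + MA * (eps * x).
    have -> : A z = A y - A (y - z) by rewrite linearB opprB addrC subrK.
    apply: le_trans (ler_rnormD _ _) _; rewrite rnormN lerD2l.
    by apply: le_trans (AM _) _; rewrite ler_wpM2l// ltW.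
  have epsM : MA * eps <= eta / 2.
    have : eps <= eta / (2 * MA) by rewrite ge_min lexx orbT.
    rewrite ler_pdivlMr ?mulr_gt0//; lra.
  have Ay2 : rnorm (A y) <= eta / 2 * x.
    have h1 : S * rnorm (A y) <= sigma * rnorm (A y) by rewrite ler_wpM2r ?rnorm_ge0.
    rewrite -(ler_pM2l S_gt0); have := ler_wpM2r x0 S_eta; lra.
  have := ler_wpM2r x0 epsM; rewrite -/z; lra.
- by apply: (power_pole_dom a0 circ0) => //; rewrite arho lexx.
Qed.

(** Write y = (1 - (rho A)^(N+1)) v with A v small. Then A y = A v - rho (rho A)^N A (A v), where
    the last term is at most rho C0 |A (A y)|. It is also A (A v') for v' = - rho (rho A)^N v, and
    |A v'| <= rho C0 |A y|. *)
Lemma isolated_spectrum_range : exists K : R, [/\ 0 <= K,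
  forall y, rnorm (A y) <= K * rnorm (A (A y)) &
  forall y e, 0 < e -> exists v,
    rnorm (A v) <= K * rnorm (A y) /\ rnorm (A (A v) - A y) <= e].
Proof.
have [rho [C0 [rho0 C01 conc]]] := pole_concentration.
have small y e : 0 < e -> exists v N, [/\ polyop A (pole rho N.+1) v = y,
    rnorm (A v) <= e & dom A ((rho%:C *: 'X) ^+ N) (pole rho N.+1) C0].
  move=> e0; have y1 : 0 < rnorm y + 1 by rewrite ltr_wpDl ?rnorm_ge0.
  have [N [h1 h2 /(_ y)[v vE]]] := conc _ (divr_gt0 e0 y1).
  exists v, N; split=> //; have := h1 v; rewrite polyopX vE => /le_trans; apply.
  by rewrite mulrAC ler_pdivrMr// ler_wpM2l ?(ltW e0)// lerDl.
exists (rho * C0); split => [|y|y e e0].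
- by rewrite mulr_ge0//; lra.
- apply/ler_addgt0Pr => e e0; have [v [N [vE Av pd]]] := small y e e0.
  have yE : A y = A v - rho%:C *: polyop A ((rho%:C *: 'X) ^+ N) (A (A v)).
    rewrite -vE /pole polyopB polyop1 linearB /= exprSr -scalerAr polyopZ polyopMX.
    by rewrite linearZ /= !polyopA.
  rewrite [X in rnorm X <= _]yE; apply: le_trans (ler_rnormD _ _) _.
  rewrite rnormN rnormZ rnormC gtr0_norm//.
  rewrite [leRHS]addrC lerD// -mulrA ler_wpM2l ?(ltW rho0)//.
  have := pd (A (A v)); by rewrite !(polyopA A (pole _ _)) vE.
- have [v [N [vE Av pd]]] := small y e e0.
  exists (- rho%:C *: polyop A ((rho%:C *: 'X) ^+ N) v); split.
    rewrite linearZ /= rnormZ rnormN rnormC gtr0_norm// -mulrA ler_wpM2l ?(ltW rho0)//.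
    by rewrite -polyopA; have := pd (A v); rewrite (polyopA A (pole _ _)) vE.
  suff -> : A (A (- rho%:C *: polyop A ((rho%:C *: 'X) ^+ N) v)) - A y = - A v.
    by rewrite rnormN.
  rewrite -vE /pole polyopB polyop1 linearB /= exprSr -scalerAr polyopZ polyopMX.
  rewrite !linearZ /= !scaleNr !polyopA !linearZ /=.
  by rewrite opprD addrCA addrN addr0.
Qed.

End IsolatedSpectrum.

(** * The relation A B = lambda B A *)

Section Commutation.
Context {R : realType} {H : hilbertType R} (A B : boundedOperator H) (lambda : R[i]).
Context (AB : forall x, A (B x) = lambda *: B (A x)).
Context (MA MB K : R) (MA_gt0 : 0 < MA) (K_ge0 : 0 <= K) (MB_ge0 : 0 <= MB).
Context (AM : forall x, rnorm (A x) <= MA * rnorm x).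
Context (BM : forall x, rnorm (B x) <= MB * rnorm x).

Lemma commute_iter n x : A (iter n B x) = lambda ^+ n *: iter n B (A x).
Proof.
elim: n x => [|n IH] x; first by rewrite scale1r.
by rewrite iterS AB IH linearZ /= scalerA exprS.
Qed.

Lemma rnorm_iter_le n x : rnorm (iter n B x) <= MB ^+ n * rnorm x.
Proof.
elim: n => [|n IH]; first by rewrite mul1r.
by rewrite exprS -mulrA (le_trans (BM _))// ler_wpM2l.
Qed.

(** Iterating the improvement gives the bounds c0 2^-n, which tend to 0. *)
Lemma bound_halving (F : H -> H) (G : H -> R) (c0 : R) :
  0 <= c0 -> (forall v, 0 <= G v) -> (forall v, rnorm (F v) <= c0 * G v) ->
  (forall c, 0 <= c -> (forall v, rnorm (F v) <= c * G v) ->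
    forall v, rnorm (F v) <= c / 2 * G v) ->
  forall v, F v = 0.
Proof.
move=> c00 G0 F0 half v.
have hn n : forall v, rnorm (F v) <= c0 * 2^-1 ^+ n * G v.
  elim: n => [|n IH] u; first by rewrite mulr1.
  by rewrite exprSr mulrA half// mulr_ge0 ?exprn_ge0.
apply/eqP; rewrite -rnorm_eq0 eq_le rnorm_ge0 andbT; apply/ler_addgt0Pr => e e0.
have d0 : 0 < c0 * G v + 1 by rewrite ltr_wpDl ?mulr_ge0.
have half01 : 0 <= (2^-1 : R) < 1 by lra.
have [n /= nP] := filter_ex (expr_near_lt half01 (divr_gt0 e0 d0)).
rewrite add0r (le_trans (hn n v))// mulrAC.
rewrite ltr_pdivlMr// in nP; apply: le_trans (ltW nP).
by rewrite mulrC ler_wpM2l ?exprn_ge0// lerDl.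
Qed.

(** The lower bound at B^n v gives |B^n A v| <= K |lambda|^n |B^n A (A v)|; so a bound c improves to
    K MA |lambda|^n c <= c / 2. *)
Lemma iter_range_eq0_lt n : lambda != 0 ->
  (forall y, rnorm (A y) <= K * rnorm (A (A y))) ->
  K * rnorm lambda ^+ n * MA <= 2^-1 -> forall v, iter n B (A v) = 0.
Proof.
move=> l0 AK nP.
apply: (bound_halving (G := fun v => rnorm (A v)) (c0 := MB ^+ n)).
- exact: exprn_ge0.
- by move=> v; exact: rnorm_ge0.
- by move=> v; exact: rnorm_iter_le.
move=> c c0 cP v; have ln : 0 < rnorm lambda ^+ n by rewrite exprn_gt0// rnorm_gt0.
have h1 : rnorm lambda ^+ n * rnorm (iter n B (A v)) <=
    K * (rnorm lambda ^+ n * (rnorm lambda ^+ n * rnorm (iter n B (A (A v))))).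
  have := AK (iter n B v).
  by rewrite !(commute_iter, linearZ) /= commute_iter !rnormZ !rnormX.
have h2 : rnorm (iter n B (A v)) <=
    K * rnorm lambda ^+ n * rnorm (iter n B (A (A v))).
  by rewrite -(ler_pM2l ln); move: h1; rewrite !mulrA (mulrC K).
apply: le_trans h2 _.
have h3 : rnorm (iter n B (A (A v))) <= c * (MA * rnorm (A v)).
  by apply: le_trans (cP _) _; rewrite ler_wpM2l.
have Kl : 0 <= K * rnorm lambda ^+ n by rewrite mulr_ge0 ?(ltW ln).
apply: le_trans (ler_wpM2l Kl h3) _.
have := ler_wpM2r (mulr_ge0 c0 (rnorm_ge0 (A v))) nP; lra.
Qed.

(** For A (A v) close to A y, |lambda|^n |B^n A (A v)| = |A B^n (A v)| <= MA c |A v| <= MA K c |A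
    y|, so c improves to c / 2. *)
Lemma iter_range_eq0_gt n :
  (forall y e, 0 < e -> exists v,
    rnorm (A v) <= K * rnorm (A y) /\ rnorm (A (A v) - A y) <= e) ->
  0 < rnorm lambda -> K * MA <= rnorm lambda ^+ n / 2 ->
  forall v, iter n B (A v) = 0.
Proof.
move=> approx l0 nP.
apply: (bound_halving (G := fun v => rnorm (A v)) (c0 := MB ^+ n)).
- exact: exprn_ge0.
- by move=> v; exact: rnorm_ge0.
- by move=> v; exact: rnorm_iter_le.
move=> c c0 cP y; have ln : 0 < rnorm lambda ^+ n by rewrite exprn_gt0.
apply/ler_addgt0Pr => e e0.
have M1 : 0 < MB ^+ n + 1 by rewrite ltr_wpDl ?exprn_ge0.
have [v [vK ve]] := approx y _ (divr_gt0 e0 M1).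
have iterB u w : iter n B (u - w) = iter n B u - iter n B w.
  by elim: n {nP ln M1 ve cP} => //= n ->; rewrite linearB.
have -> : iter n B (A y) = iter n B (A (A v)) - iter n B (A (A v) - A y).
  by rewrite iterB opprB addrC subrK.
apply: le_trans (ler_rnormD _ _) _; rewrite rnormN; apply: lerD.
  rewrite -(ler_pM2l ln) -rnormX -rnormZ -commute_iter rnormX.
  apply: le_trans (AM _) _.
  have h1 : rnorm (iter n B (A v)) <= c * (K * rnorm (A y)).
    by apply: le_trans (cP _) _; rewrite ler_wpM2l.
  have h2 := ler_wpM2l (ltW MA_gt0) h1.
  have h3 := ler_wpM2r (mulr_ge0 c0 (rnorm_ge0 (A y))) nP; lra.
apply: le_trans (rnorm_iter_le _ _) _.
rewrite ler_pdivlMr// mulrC in ve; apply: le_trans ve.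
by rewrite ler_wpM2r ?rnorm_ge0// lerDl.
Qed.

(** The exponent goes down one at a time: B^(n+2) A = 0 gives B^3 (B^n A u) = 0, hence B (B^n A u) =
    0. *)
Lemma quasi_star_paranormal_iter n : quasi_star_paranormal B ->
  (forall v, iter n B (A v) = 0) -> forall v, B (A v) = 0.
Proof.
move=> hB; elim: n => [|[|n] IH] nil v.
- by rewrite (nil v : A v = 0) linear0.
- exact: (nil v).
apply: IH => u; apply: (quasi_star_paranormal_kernel hB).
by have /= -> := nil u; rewrite linear0.
Qed.

End Commutation.

(** * Use of the two spectral hypotheses *)

Section Invertible.
Context {R : realType} {H : hilbertType R} (A : boundedOperator H).

(** K bounds the inverse S, and v = S y makes the approximation exact. *)
Lemma invertible_range : invertible A -> exists K : R, [/\ 0 <= K,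
  forall y, rnorm (A y) <= K * rnorm (A (A y)) &
  forall y e, 0 < e -> exists v,
    rnorm (A v) <= K * rnorm (A y) /\ rnorm (A (A v) - A y) <= e].
Proof.
move=> [S [AK SK]]; have [K K0 SM] := bounded_rnorm S.
exists K; split=> [|y|y e e0]; first exact: ltW.
  by have := SM (A (A y)); rewrite AK.
exists (S y); rewrite !SK subrr rnorm0; split; last exact: ltW.
by have := SM (A y); rewrite AK.
Qed.

(** The inversion w = 1/z turns a punctured disc |z| < d free of spectrum into |w| > 1/d, and 1 - w
    A = - w (A - 1/w). *)
Lemma isolated_regular : isolated (spectrum A : set R[i]^o) 0 ->
  exists2 L : R, 0 <= L & forall w : R[i], L < rnorm w ->
  (exists C, forall x, rnorm x <= C * rnorm (x - w *: A x)) /\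
  (forall y, exists x, x - w *: A x = y).
Proof.
move=> [_ [U /nbhs_ballP[e /= e0 eU] Uspec]].
have [d dE] : exists d, e = d%:C by apply/complex_realP/gtr0_real.
move: e0; rewrite dE ltcR => d0.
exists d^-1 => [|w wd]; first by rewrite invr_ge0 ltW.
have rw : 0 < rnorm w by apply: lt_trans wd; rewrite invr_gt0.
have w0 : w != 0 by rewrite -rnorm_gt0.
have /contrapT[S [AS SA]] : ~ spectrum A w^-1.
  move=> wspec; suff : [set (0 : R[i]^o)] w^-1.
    by move=> /= /eqP; rewrite invr_eq0 (negPf w0).
  rewrite -Uspec; split=> //; apply: eU; rewrite dE -ball_normE /ball_ /= sub0r normrN.
  by rewrite normE ltcR rnormV invf_plt ?posrE.
have wE x : x - w *: A x = - w *: (A x - w^-1 *: x).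
  by rewrite scalerBr scalerA mulNr divff// scaleN1r opprK scaleNr addrC.
have [M M0 SM] := bounded_rnorm S.
split; [exists (M / rnorm w) => x | move=> y; exists (S (- w^-1 *: y))].
  rewrite wE rnormZ rnormN mulrA divfK ?gt_eqF//.
  by have := SM (A x - w^-1 *: x); rewrite AS.
by rewrite wE SA scalerA mulrNN divff// scale1r.
Qed.

End Invertible.

(* R[i]^o is R[i] with its usual topology. *)
Theorem theorem2p1 (R : realType) (H : hilbertType R)
    (A B : boundedOperator H) (lambda : R[i])
    (hAB : A \o B =1 lambda \*: (B \o A))
    (hAB0 : ~ (A \o B =1 \0))
    (hA : hyponormal A)
    (hB : quasi_star_paranormal B)
    (hinv : invertible A \/ isolated (spectrum A : set R[i]^o) 0) :
  `|lambda| = 1.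
Proof.
have [MA MA0 AM] := bounded_rnorm A; have [MB MB0 BM] := bounded_rnorm B.
have AB x : A (B x) = lambda *: B (A x) by exact: hAB.
have l0 : lambda != 0.
  by apply/eqP => l0; apply: hAB0 => x /=; rewrite AB l0 scale0r.
have rl0 : 0 < rnorm lambda by rewrite rnorm_gt0.
have not_nil n : ~ (forall v, iter n B (A v) = 0).
  move=> /(quasi_star_paranormal_iter hB) BA; apply: hAB0 => x /=.
  by rewrite AB BA scaler0.
have [K [K0 lower approx]] : exists K : R, [/\ 0 <= K,
    forall y, rnorm (A y) <= K * rnorm (A (A y)) &
    forall y e, 0 < e -> exists v,
      rnorm (A v) <= K * rnorm (A y) /\ rnorm (A (A v) - A y) <= e].
  case: hinv => [|/isolated_regular[L L0 regular]]; first exact: invertible_range.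
  apply: (isolated_spectrum_range MA0 AM L0 regular) => x.
  exact: hyponormal_paranormal.
(* Both cases take n with |lambda|^n or |lambda|^-n below the inverse of this number; the summand 1
   covers K = 0. *)
have KM : 0 < 2 * (K * MA) + 1 by rewrite ltr_wpDl ?mulr_ge0// ltW.
rewrite normE; congr (_%:C); apply/eqP; rewrite eq_le; apply/andP; split;
  rewrite leNgt; apply/negP => hl.
(* |lambda| > 1 would annihilate B^n A through the approximation property. *)
- have ql : 0 <= (rnorm lambda)^-1 < 1.
    by rewrite invr_ge0 ltW//= invf_lt1.
  have e0 : 0 < (2 * (K * MA) + 1)^-1 by rewrite invr_gt0.
  have [n /= nP] := filter_ex (expr_near_lt ql e0).
  apply: (not_nil n); apply: (iter_range_eq0_gt AB MA0 (ltW MB0) AM BM approx) => //.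
  by move: nP; rewrite exprVn ltf_pV2 ?posrE ?exprn_gt0//; lra.
(* |lambda| < 1 would do so through the lower bound for A on its range. *)
- have ql : 0 <= rnorm lambda < 1 by rewrite ltW.
  have e0 : 0 < (2 * (K * MA) + 1)^-1 by rewrite invr_gt0.
  have [n /= nP] := filter_ex (expr_near_lt ql e0).
  apply: (not_nil n); apply: (iter_range_eq0_lt AB K0 (ltW MB0) AM BM) => //.
  rewrite -[_^-1]mul1r ltr_pdivlMr// in nP.
  have := exprn_ge0 n (ltW rl0); lra.
Qed.
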